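(* For any graph $G$ of order $n\ge 7$ and any $k\in\{1,\ldots,\mathcal{C}(G)\}$, $\operatorname{adim}_k(G)\ge k+2$.
   Context: All graphs are finite and simple. For a graph $G=(V,E)$, $d_{G,2}(x,y)=\min\{d_G(x,y),2\}$ with $d_G$ the shortest-path distance ($\infty$ between different components). For distinct $x,y$, $\mathcal{C}_G(x,y)=\{z\in V: d_{G,2}(x,z)\ne d_{G,2}(y,z)\}$ and $\mathcal{C}(G)=\min_{x\ne y}|\mathcal{C}_G(x,y)|$. A set $S\subseteq V$ is a $k$-adjacency generator if $|S\cap\mathcal{C}_G(x,y)|\ge k$ for all distinct $x,y$; $\operatorname{adim}_k(G)$ is the minimum cardinality of such a set. *)

(* Defs.v *)
From mathcomp Require Import all_boot.

Set Implicit Arguments.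
Unset Strict Implicit.
Unset Printing Implicit Defensive.

(* A simple graph is a symmetric irreflexive edge relation e on a finType T. *)

Section AdjacencyDimension.

Variables (T : finType) (e : rel T).

Definition walk (x y : T) (n : nat) : bool :=
  [exists p : n.-tuple T, path e x p && (last x p == y)].

Lemma connect_walk (x y : T) : connect e x y -> exists n, walk x y n.
Proof.
move=> /connectP[p ep ->]; exists (size p); apply/existsP.
by exists (in_tuple p); rewrite ep eqxx.
Qed.

(* None stands for infinity. *)
Definition dist (x y : T) : option nat :=
  if @idP (connect e x y) is ReflectT xy
  then Some (ex_minn (connect_walk xy)) else None.

Definition dist2 (x y : T) : nat :=
  if dist x y is Some d then minn d 2 else 2.

Definition dset (x y : T) : {set T} := [set z | dist2 x z != dist2 y z].

(* The idx value #|T| bounds every term, so it affects the minimum only when *)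
(* there is no pair of distinct vertices.                                    *)
Definition dnum : nat :=
  \big[minn/#|T|]_(p : T * T | p.1 != p.2) #|dset p.1 p.2|.

Definition adj_generator (k : nat) (S : {set T}) : bool :=
  [forall x, forall y, (x != y) ==> (k <= #|S :&: dset x y|)].

(* The idx value #|T| bounds every term, so it affects the minimum only when *)
(* no generator exists; setT is one whenever k <= dnum.                      *)
Definition adim (k : nat) : nat :=
  \big[minn/#|T|]_(S : {set T} | adj_generator k S) #|S|.

End AdjacencyDimension.

(* Main.v *)
(* If [S] were a k-adjacency generator with at most [k + 1] elements, delete two
   elements [b], [c] of [S]: fewer than [k] remain, so [b] and [c] alone must
   already separate any two vertices other than [b] and [c].  Such a vertex is
   then determined by whether it is adjacent to [b] and whether it is adjacent
   to [c], which leaves at most 4 + 2 = 6 vertices. *)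
Require Import Defs.
From mathcomp Require Import all_boot all_order.

Lemma walk1 (T : finType) (e : rel T) (x y : T) : walk e x y 1 = e x y.
Proof.
apply/existsP/idP => [[p]|exy]; last by exists [tuple y]; rewrite /= exy eqxx.
by case/tupleP: p => z p; rewrite (tuple0 p) /= andbT => /andP[exz /eqP<-].
Qed.

(** Distance 0 is excluded by [x != y], distance 1 is adjacency, and everything else, including
    [None], is truncated to 2. *)
Lemma dist2_neq (T : finType) (e : rel T) (x y : T) :
  x != y -> dist2 e x y = if e x y then 1 else 2.
Proof.
move=> xy; rewrite /dist2 /dist; case: {-}_ / idP => [cxy|ncxy]; last first.
  by case: ifP => // exy; case: ncxy; apply: connect1.
case: ex_minnP => -[|[|n]] wn n_min.
- by case/existsP: wn => p; rewrite (tuple0 p) /= (negPf xy).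
- by rewrite -walk1 wn.
- case: ifP => [|_]; first by rewrite -walk1 => /n_min.
  by apply/minn_idPr.
Qed.

(** If the images of [x] and [y] agree, neither [b] nor [c] lies in [dset e x y], so this set meets
    [S] only inside [S :\: [set b; c]], in fewer than [k] points. *)
Lemma generator_neighbors_inj (T : finType) (e : rel T) (k : nat)
    (S : {set T}) (b c : T) :
  adj_generator e k S -> #|S :\: [set b; c]| < k ->
  {in ~: [set b; c] &, injective (fun x => (e x b, e x c))}.
Proof.
move=> genS ltk x y; rewrite !inE !negb_or => /andP[xb xc] /andP[yb yc].
case=> exyb exyc; apply/eqP; apply: contraLR ltk => xy; rewrite -leqNgt.
move/forallP/(_ x)/forallP/(_ y): genS; rewrite xy => /leq_trans; apply.
apply/subset_leq_card/subsetP => z; rewrite !inE => /andP[->].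
rewrite andbT negb_or => dz; apply/andP; split; apply: contraNneq dz => ->.
  by rewrite !dist2_neq // exyb.
by rewrite !dist2_neq // exyc.
Qed.

(** Allowing [b = c], or points outside [S], covers sets with fewer than two elements, where the
    subtraction truncates to 0. *)
Lemma exists_set2_cardD (T : finType) (S : {set T}) :
  0 < #|T| -> exists b c : T, #|S :\: [set b; c]| = #|S| - 2.
Proof.
case/card_gt0P => x0 _.
have [->|[b bS]] := set_0Vmem S.
  by exists x0, x0; rewrite set0D cards0.
have [Sb0|[c]] := set_0Vmem (S :\ b).
  by exists b, b; rewrite setUid Sb0 cards0 (cardsD1 b) bS Sb0 cards0.
rewrite !inE => /andP[cb cS]; exists b, c.
rewrite cardsD (setIidPr _) ?cards2 1?eq_sym ?cb //.
by apply/subsetP => z /set2P[] ->.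
Qed.

Lemma card_adj_generator (T : finType) (e : rel T) (k : nat) (S : {set T}) :
  7 <= #|T| -> 0 < k -> adj_generator e k S -> k + 2 <= #|S|.
Proof.
move=> T_ge7 k_gt0 genS; rewrite leqNgt; apply/negP => ltS.
have [b [c cardSD]] := exists_set2_cardD _ S (leq_ltn_trans (leq0n 6) T_ge7).
have ltSD : #|S :\: [set b; c]| < k.
  (* Since the subtraction truncates, this relies on [0 < k]. *)
  by rewrite cardSD ltn_psubLR // addnC.
have := leq_card_in _ _ (generator_neighbors_inj T e k S b c genS ltSD).
rewrite card_prod card_bool leqNgt => /negP; apply.
rewrite -(leq_add2l #|[set b; c]|) cardsC.
by apply: leq_trans T_ge7; rewrite cards2; case: (b != c).
Qed.

Lemma adj_generatorT (T : finType) (e : rel T) (k : nat) :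
  k <= dnum e -> adj_generator e k setT.
Proof.
move=> k_le; apply/forallP => x; apply/forallP => y; apply/implyP => xy.
rewrite setTI (leq_trans k_le) //.
exact: (Order.TotalTheory.bigmin_le_cond _ (j := (x, y))
  (fun p => #|dset e p.1 p.2|)).
Qed.

Theorem theorem18 (T : finType) (e : rel T)
    (e_sym : symmetric e) (e_irr : irreflexive e)
    (n : nat) (hn : #|T| = n) (n_ge7 : 7 <= n)
    (k : nat) (hk : 1 <= k <= dnum e) :
  k + 2 <= adim e k.
Proof.
case/andP: hk => k_gt0 k_le; rewrite -hn in n_ge7.
apply: (big_ind (fun m => k + 2 <= m)) => [|p q kp kq|S]; last exact: card_adj_generator.
  (* The default [#|T|] of the minimum is the size of [setT], itself a generator because
     [k <= dnum e]. *)
  rewrite -cardsT; exact: card_adj_generator (adj_generatorT _ _ _ k_le).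
by rewrite leq_min kp.
Qed.
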